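(* Let $I\subseteq(0,\infty)$ be an interval with interior $I^\circ$, let $f:I\to\mathbb{R}$ be differentiable on $I^\circ$, and let $a,b\in I^\circ$ with $a<b$ and $f'\in L[a,b]$. Let $q>1$ and $s\in(0,1]$. (a) If $|f'|^q$ is GA-$s$-convex in the second sense on $[a,b]$, then $$\left|\frac{f(a)+f(b)}{2}-\frac{1}{\ln b-\ln a}\int_a^b\frac{f(x)}{x}dx\right|\leq \frac{\ln(b/a)}{2}\left(\frac{q-1}{2q-1}\right)^{1-\frac1q}\Big[a\big\{c_7(s,q)|f'(a)|^q+c_8(s,q)|f'(b)|^q\big\}^{\frac1q}+b\big\{c_9(s,q)|f'(b)|^q+c_{10}(s,q)|f'(a)|^q\big\}^{\frac1q}\Big]$$ and $$\left|f(\sqrt{ab})-\frac{1}{\ln b-\ln a}\int_a^b\frac{f(x)}{x}dx\right|\leq \frac{\ln(b/a)}{4}\left(\frac{q-1}{2q-1}\right)^{1-\frac1q}\Big[a\big\{c_7(s,q/2)|f'(a)|^q+c_8(s,q/2)|f'(\sqrt{ab})|^q\big\}^{\frac1q}+b\big\{c_9(s,q/2)|f'(b)|^q+c_{10}(s,q/2)|f'(\sqrt{ab})|^q\big\}^{\frac1q}\Big].$$ (b) If $|f'|^q$ is GA-$s$-convex in the first sense on $[a,b]$, then $$\left|\frac{f(a)+f(b)}{2}-\frac{1}{\ln b-\ln a}\int_a^b\frac{f(x)}{x}dx\right|\leq \frac{\ln(b/a)}{2}\left(\frac{q-1}{2q-1}\right)^{1-\frac1q}\Big[a\big\{c_{11}(s,q)|f'(a)|^q+c_8(s,q)|f'(b)|^q\big\}^{\frac1q}+b\big\{c_{12}(s,q)|f'(b)|^q+c_{10}(s,q)|f'(a)|^q\big\}^{\frac1q}\Big]$$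 and $$\left|f(\sqrt{ab})-\frac{1}{\ln b-\ln a}\int_a^b\frac{f(x)}{x}dx\right|\leq \frac{\ln(b/a)}{4}\left(\frac{q-1}{2q-1}\right)^{1-\frac1q}\Big[a\big\{c_{11}(s,q/2)|f'(a)|^q+c_8(s,q/2)|f'(\sqrt{ab})|^q\big\}^{\frac1q}+b\big\{c_{12}(s,q/2)|f'(b)|^q+c_{10}(s,q/2)|f'(\sqrt{ab})|^q\big\}^{\frac1q}\Big].$$ Here, for $p>0$, $$c_7(s,p)=\int_0^1(1-t)^s\left(\tfrac ba\right)^{pt}dt,\quad c_8(s,p)=\int_0^1 t^s\left(\tfrac ba\right)^{pt}dt,\quad c_9(s,p)=\int_0^1(1-t)^s\left(\tfrac ab\right)^{pt}dt,$$ $$c_{10}(s,p)=\int_0^1 t^s\left(\tfrac ab\right)^{pt}dt,\quad c_{11}(s,p)=\int_0^1(1-t^s)\left(\tfrac ba\right)^{pt}dt,\quad c_{12}(s,p)=\int_0^1(1-t^s)\left(\tfrac ab\right)^{pt}dt.$$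
   Context: Let $0<s\le 1$. A function $g:J\subseteq[0,\infty)\to\mathbb{R}$ is GA-$s$-convex in the first sense on $J$ if $g(x^t y^{1-t})\leq t^s g(x)+(1-t^s)g(y)$ for all $x,y\in J$, $t\in[0,1]$; it is GA-$s$-convex in the second sense on $J$ if $g(x^t y^{1-t})\leq t^s g(x)+(1-t)^s g(y)$ for all $x,y\in J$, $t\in[0,1]$ (with $0^s=0$). $L[a,b]$ denotes the set of (Lebesgue) integrable functions on $[a,b]$. *)

(* Defs.v *)
From HB Require Import structures.
From mathcomp Require Import all_boot all_order all_algebra.
From mathcomp Require Import all_classical all_reals all_analysis.

Set Implicit Arguments.
Unset Strict Implicit.
Unset Printing Implicit Defensive.

Import Order.TTheory GRing.Theory Num.Theory.
Import numFieldNormedType.Exports.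

Local Open Scope classical_set_scope.
Local Open Scope ring_scope.

(* Both notions are meant for J included in [0, +oo[ and 0 < s <= 1, so that
   0 `^ s = 0; powR also satisfies 0 `^ 0 = 1, and hence x `^ 0 * y `^ 1 = y
   even when x = 0. Only the values of g on J matter when J is closed under
   weighted geometric means, as is any interval of positive reals. *)
Definition GA_s_convex_first (R : realType) (s : R) (J : set R) (g : R -> R) :=
  forall x y t : R, J x -> J y -> 0 <= t <= 1 ->
    g (x `^ t * y `^ (1 - t)) <= t `^ s * g x + (1 - t `^ s) * g y.

Definition GA_s_convex_second (R : realType) (s : R) (J : set R) (g : R -> R) :=
  forall x y t : R, J x -> J y -> 0 <= t <= 1 ->
    g (x `^ t * y `^ (1 - t)) <= t `^ s * g x + (1 - t) `^ s * g y.

Definition c7 (R : realType) (a b s p : R) : R :=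
  \int[lebesgue_measure]_(t in `[0%R, 1%R]) ((1 - t) `^ s * (b / a) `^ (p * t)).

Definition c8 (R : realType) (a b s p : R) : R :=
  \int[lebesgue_measure]_(t in `[0%R, 1%R]) (t `^ s * (b / a) `^ (p * t)).

Definition c9 (R : realType) (a b s p : R) : R :=
  \int[lebesgue_measure]_(t in `[0%R, 1%R]) ((1 - t) `^ s * (a / b) `^ (p * t)).

Definition c10 (R : realType) (a b s p : R) : R :=
  \int[lebesgue_measure]_(t in `[0%R, 1%R]) (t `^ s * (a / b) `^ (p * t)).

Definition c11 (R : realType) (a b s p : R) : R :=
  \int[lebesgue_measure]_(t in `[0%R, 1%R]) ((1 - t `^ s) * (b / a) `^ (p * t)).

Definition c12 (R : realType) (a b s p : R) : R :=
  \int[lebesgue_measure]_(t in `[0%R, 1%R]) ((1 - t `^ s) * (a / b) `^ (p * t)).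

(* Main.v *)
Require Import Defs.
From HB Require Import structures.
From mathcomp Require Import all_boot all_order all_algebra.
From mathcomp Require Import all_classical all_reals all_analysis.
From mathcomp Require Import measurable_realfun ring lra.

Set Implicit Arguments.
Unset Strict Implicit.
Unset Printing Implicit Defensive.

Import Order.TTheory GRing.Theory Num.Theory.
Import numFieldNormedType.Exports.

Local Open Scope classical_set_scope.
Local Open Scope ring_scope.

(** In the logarithmic variable, the trapezoid and midpoint errors are both
    averages of two one-sided errors. For positive [x != y] let
    [g t = y `^ t * x `^ (1 - t)] and [Phi = f \o g]. The logarithmic mean of [f]
    between [x] and [y] is [\int_0^1 Phi], and integration by parts gives
    [[ f y - \int_0^1 Phi = \int_0^1 t * Phi' t
                           = (ln y - ln x) * \int_0^1 t * g t * f' (g t). ]]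
    Hoelder's inequality separates [t], whose [L^p] norm for the conjugate
    exponent [p] of [q] is [((q - 1) / (2 * q - 1)) `^ (1 - q^-1)], from
    [g t * f' (g t) = x * (y / x) `^ t * f' (g t)]. The convexity of [`|f'| `^ q]
    then bounds the [q]-th power of the second factor, and its integral is the
    combination of [`|f' x| `^ q] and [`|f' y| `^ q] in the statement. Averaging
    over [(x, y) = (a, b)] and [(b, a)] gives the trapezoid inequality, and over
    [(a, m)] and [(b, m)] with [m] the geometric mean of [a] and [b] the midpoint
    one.

    Since [f'] may be discontinuous, the integration by parts above would need
    the fundamental theorem of calculus for a general derivative. It is bypassed:
    only upper bounds of [f'] that are continuous in the open interval occur
    under an integral sign, and a mean value inequality ([le_increment]) compares
    [t * Phi t], minus a primitive of [Phi], with a primitive of such a bound.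
    Hoelder's inequality enters that comparison pointwise, as Young's
    ([young_normalized], [kernel_bound]). The change of variable by [g] is
    avoided in the same way, by composing a primitive of [f u / u] with [g]
    ([geom_path_bound]). *)

(** * The averaging kernel on [0, 1] *)

Section mean_value.
Context {R : realType}.
Local Notation mu := (@lebesgue_measure R).

(** This form of the mean value inequality asks only for pointwise derivatives,
    so that a derivative which may be discontinuous never has to be integrated.
    Its proof applies the mean value theorem to [B - A] and to [B + A], both of
    which have a nonnegative derivative. *)
Lemma le_increment (A B dA dB : R -> R) (a b : R) : a < b ->
  {within `[a, b], continuous A} -> {within `[a, b], continuous B} ->
  {in `]a, b[, forall t : R, is_derive t (1 : R) A (dA t)} ->
  {in `]a, b[, forall t : R, is_derive t (1 : R) B (dB t)} ->
  {in `]a, b[, forall t : R, `|dA t| <= dB t} ->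
  `|A b - A a| <= B b - B a.
Proof.
move=> ab cA cB dvA dvB leAB.
have [||c cab Ec] := @MVT R (B - A) (dB - dA) a b ab.
- by move=> t tab; apply: is_deriveB; [exact: dvB|exact: dvA].
- by move=> t; exact: continuousD (cB t) (continuousN (cA t)).
have [||d dab Ed] := @MVT R (B + A) (dB + dA) a b ab.
- by move=> t tab; apply: is_deriveD; [exact: dvB|exact: dvA].
- by move=> t; exact: continuousD (cB t) (cA t).
have Bc : 0 <= (dB - dA) c * (b - a).
  rewrite mulr_ge0 ?subr_ge0 ?(ltW ab)//.
  exact: le_trans (ler_norm _) (leAB c cab).
have Bd : 0 <= (dB + dA) d * (b - a).
  rewrite mulr_ge0 ?subr_ge0 ?(ltW ab)//.
  rewrite -[(dB + dA) d]/(dB d + dA d) -[dA d]opprK subr_ge0.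
  by apply: le_trans (leAB d dab); rewrite -normrN ler_norm.
rewrite -Ec in Bc; rewrite -Ed in Bd.
rewrite ler_norml; move: Bc Bd.
rewrite -[(B - A) b]/(B b - A b) -[(B - A) a]/(B a - A a).
rewrite -[(B + A) b]/(B b + A b) -[(B + A) a]/(B a + A a).
by lra.
Qed.

Lemma powR_continuous (r t : R) : 0 < t ->
  {for t, continuous (fun u : R => u `^ r)}.
Proof.
move=> t0; have [d _] := is_derive1_powR r t0.
by apply: differentiable_continuous; apply/derivable1_diffP.
Qed.

Lemma powR_within_continuous (r b : R) : 0 < r -> 0 < b ->
  {within `[0, b], continuous (fun t : R => t `^ r)}.
Proof.
move=> r0 b0; apply/continuous_within_itvP => //; split.
- by move=> t; rewrite in_itv /= => /andP[t0 _]; exact: powR_continuous.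
- by rewrite powR0 ?gt_eqF//; exact: powR_cvg0.
- exact: cvg_at_left_filter (powR_continuous _).
Qed.

Lemma powR_itv01 (r t : R) : 0 < r -> 0 <= t <= 1 -> 0 <= t `^ r <= 1.
Proof.
move=> r0 /andP[t0 t1]; rewrite powR_ge0/=.
apply: (@le_trans _ _ (1 `^ r)); last by rewrite powR1.
by apply: ge0_ler_powR; rewrite ?nnegrE// ltW.
Qed.

(** Young's inequality for the conjugate exponents [p] and [q], applied to
    [t / N] and [(H / K) `^ q^-1]. The constant
    [N = ((q - 1) / (2 * q - 1)) `^ (1 - q^-1)] is the [L^p] norm of the identity
    of [0, 1], since [p + 1 = (2 * q - 1) / (q - 1)]; it is chosen so that the
    integral over [0, 1] of the first summand on the right is [p^-1]. Once [K]
    exceeds the integral of [H], the whole bracket integrates to at most 1,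
    which is Hoelder's inequality. *)
Lemma young_normalized (q C K t h H : R) : 1 < q -> 0 < K -> 0 <= t -> 0 <= H ->
  h <= C * H `^ q^-1 -> 0 <= C ->
  let p := q / (q - 1) in
  t * h <= C * ((q - 1) / (2 * q - 1)) `^ (1 - q^-1) * K `^ q^-1 *
    ((p + 1) * t `^ p / p + H / (q * K)).
Proof.
move=> q1 K0 t0 H0 hH C0; set p := q / (q - 1); cbv zeta.
have q0 : 0 < q by lra.
have p0 : 0 < p by rewrite divr_gt0//; lra.
have pV : p^-1 = 1 - q^-1 by rewrite /p; field; lra.
have pq : p^-1 + q^-1 = 1 by rewrite pV; ring.
set N := _ `^ (1 - q^-1).
have bs0 : 0 < (q - 1) / (2 * q - 1) by rewrite divr_gt0//; lra.
have N0 : 0 < N by exact: powR_gt0.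
have Np : N^-1 `^ p = p + 1.
  rewrite -powR_inv1 ?(ltW N0)// powRAC /N -pV -(powRrM _ p^-1) mulVf ?gt_eqF//.
  rewrite powRr1 ?(ltW bs0)// powR_inv1 ?(ltW bs0)//.
  by rewrite /p; field; lra.
have Kq0 : 0 < K `^ q^-1 by exact: powR_gt0.
have Hq : ((H `^ q^-1) / K `^ q^-1) `^ q = H / K.
  rewrite powRM ?powR_ge0 ?invr_ge0 ?ltW// -[(K `^ _)^-1]powR_inv1 ?(ltW Kq0)//.
  rewrite (powRAC _ (-1)) -!(powRrM _ q^-1) mulVf ?gt_eqF// !powRr1//.
  - by rewrite powR_inv1// ltW.
  - exact: ltW.
have := @conjugate_powR R (t / N) (H `^ q^-1 / K `^ q^-1) p q _ _ p0 q0 pq.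
have tN : (t / N) `^ p = (p + 1) * t `^ p.
  by rewrite powRM// ?invr_ge0 ?(ltW N0)// Np mulrC.
rewrite Hq tN => Y.
apply: (@le_trans _ _ (t * (C * H `^ q^-1))); first exact: ler_wpM2l.
have -> : t * (C * H `^ q^-1) =
    C * N * K `^ q^-1 * (t / N * (H `^ q^-1 / K `^ q^-1)).
  by field; rewrite ?gt_eqF.
apply: ler_wpM2l; first by rewrite !mulr_ge0// ltW.
apply: le_trans (Y _ _) _.
- by rewrite divr_ge0// ltW.
- by rewrite divr_ge0// ?powR_ge0// ltW.
rewrite le_eqVlt; apply/orP; left; apply/eqP; field.
by rewrite !gt_eqF.
Qed.

(** Young's inequality divides by an upper bound [M] of an integral [K] that can
    be zero. It is therefore used with [M > K], and this lemma lets [M] decrease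
    to [K]. *)
Lemma le_of_powR_gt (c y K r : R) : 0 < r -> 0 <= c -> 0 <= K ->
  (forall M, K < M -> y <= c * M `^ r) -> y <= c * K `^ r.
Proof.
move=> r0 c0 K0 yM; rewrite leNgt; apply/negP => lt_y.
have y0 : 0 < y by apply: le_lt_trans lt_y; rewrite mulr_ge0// powR_ge0.
have cp : 0 < c.
  rewrite lt0r c0 andbT; apply/eqP => c00.
  have := yM (K + 1); rewrite c00 mul0r => /(_ _); lra.
(* The bound would be an equality at [M = z], so any [M] strictly between [K]
   and [z] violates it. *)
pose z := (y / c) `^ r^-1.
have yz : y / c = z `^ r.
  by rewrite /z -powRrM mulVf ?gt_eqF// powRr1// divr_ge0// ltW.
have Kz : K < z.
  rewrite ltNge; apply/negP => zK.
  have : z `^ r <= K `^ r.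
    apply: ge0_ler_powR => //; rewrite ?nnegrE ?(ltW r0)//.
    exact: powR_ge0.
  by rewrite -yz ler_pdivrMr// mulrC leNgt lt_y.
have := yM ((K + z) / 2) ltac:(lra).
rewrite mulrC -ler_pdivrMr// yz leNgt => /negP; apply.
apply: gt0_ltr_powR => //; rewrite ?nnegrE; lra.
Qed.

(** Formally, [Phi 1 - (P 1 - P 0) = \int_0^1 t * Phi' t] by integration by
    parts, and Hoelder's inequality concludes. In the proof [A t = t * Phi t - P t] plays the part of the indefinite
    integral of [t * Phi' t]: it has this function as derivative because [P] is a
    primitive of [Phi]. It is compared by [le_increment] with the primitive [B]
    of the upper bound provided by [young_normalized]. *)
Lemma kernel_bound (Phi dPhi P H : R -> R) (q C : R) : 1 < q -> 0 <= C ->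
  {in `[0, 1], forall t : R, is_derive t (1 : R) Phi (dPhi t)} ->
  {in `[0, 1], forall t : R, is_derive t (1 : R) P (Phi t)} ->
  mu.-integrable `[0, 1] (EFin \o H) ->
  {in `]0, 1[, continuous H} ->
  {in `[0, 1], forall t : R, 0 <= H t} ->
  {in `[0, 1], forall t : R, `|dPhi t| <= C * H t `^ q^-1} ->
  `|Phi 1 - (P 1 - P 0)| <= C * ((q - 1) / (2 * q - 1)) `^ (1 - q^-1) *
    (\int[mu]_(t in `[0, 1]) H t) `^ q^-1.
Proof.
move=> q1 C0 dvPhi dvP iH cH H0 leH.
have sub : {subset `]0, 1[ <= `[0, 1 : R]} by exact: subset_itv_oo_cc.
have q0 : 0 < q by lra.
set N := _ `^ (1 - q^-1).
set K := \int[mu]_(t in _) _.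
have K0 : 0 <= K by apply: Rintegral_ge0 => t /=; exact: H0.
apply: le_of_powR_gt => //; rewrite ?invr_gt0 ?mulr_ge0 ?powR_ge0// => M KM.
have M0 : 0 < M by exact: le_lt_trans KM.
pose p := q / (q - 1).
have p0 : 0 < p by rewrite divr_gt0//; lra.
pose G t := parameterized_integral mu 0 t H.
pose c := C * N * M `^ q^-1.
have c0 : 0 <= c by rewrite !mulr_ge0// powR_ge0.
pose B t := c * (t `^ (p + 1) / p + G t / (q * M)).
pose A t := t * Phi t - P t.
have : `|A 1 - A 0| <= B 1 - B 0.
  apply: (@le_increment A B (fun t => t * dPhi t)
    (fun t => c * ((p + 1) * t `^ p / p + H t / (q * M)))).
  - exact: ltr01.
  - apply: derivable_within_continuous => t t01.
    have d1 := dvPhi t t01; have d2 := dvP t t01.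
    by have [] := is_deriveB (is_deriveM (is_derive_id t (1 : R)) d1) d2.
  - move=> t.
    apply: cvgM; first exact: cvg_cst.
    apply: cvgD; apply: cvgM; try exact: cvg_cst.
      by apply: powR_within_continuous => //; lra.
    exact: parameterized_integral_continuous.
  - move=> t /sub t01.
    have d1 := dvPhi t t01; have d2 := dvP t t01.
    apply: is_derive_eq (is_deriveB
      (is_deriveM (is_derive_id t (1 : R)) d1) d2) _.
    by rewrite /GRing.scale /=; ring.
  - move=> t t01.
    have t0 : 0 < t by move: t01; rewrite in_itv/= => /andP[].
    have [dG GE] : derivable G t 1 /\ G^`()%classic t = H t.
      apply: (@continuous_FTC1_closed _ H 0 t 1) => //; last exact: cH.
      by move: t01; rewrite in_itv/= => /andP[].
    have d1 : is_derive t 1 G (H t).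
      by apply: (DeriveDef dG); rewrite -derive1E.
    have d2 := is_derive1_powR (p + 1) t0.
    apply: is_derive_eq (is_deriveZ c (is_deriveD
      (is_deriveM d2 (is_derive_cst p^-1 t 1))
      (is_deriveM d1 (is_derive_cst (q * M)^-1 t 1)))) _.
    by rewrite /GRing.scale/= addrK; ring.
  - move=> t /sub t01.
    have t0 : 0 <= t by move: t01; rewrite in_itv/= => /andP[].
    rewrite normrM (ger0_norm t0).
    by apply: young_normalized => //; [exact: H0|exact: leH].
have -> : A 1 - A 0 = Phi 1 - (P 1 - P 0) by rewrite /A; ring.
move=> /le_trans; apply.
have -> : B 1 - B 0 = c * (p^-1 + K / (q * M)).
  have G0 : G 0 = 0.
    by rewrite /G /parameterized_integral set_itv1 Rintegral_set1.
  rewrite /B powR1 powR0 ?gt_eqF ?addr_gt0// G0 -[G 1]/K.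
  by ring.
rewrite -[leRHS]mulr1; apply: ler_wpM2l => //.
have -> : 1 = p^-1 + q^-1 :> R by rewrite /p; field; lra.
rewrite lerD2l// invfM mulrCA -[leRHS]mulr1; apply: ler_wpM2l.
  by rewrite invr_ge0 ltW.
by rewrite ler_pdivrMr// mul1r ltW.
Qed.

End mean_value.

(** * Geometric paths and the one-sided estimate *)

Section geometric_path.
Context {R : realType}.
Local Notation mu := (@lebesgue_measure R).

(** The exponent [t] is put on the end point, so that the path runs from [x] at
    time 0 to [y] at time 1. *)
Definition geom_path (x y t : R) : R := y `^ t * x `^ (1 - t).

Lemma geom_pathE (x y t : R) : 0 < x -> 0 < y ->
  geom_path x y t = expR (ln x + t * (ln y - ln x)).
Proof.
move=> x0 y0; rewrite /geom_path /powR !gt_eqF// -expRD; congr expR; ring.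
Qed.

Lemma geom_path_ratio (x y t : R) : 0 < x -> 0 < y ->
  geom_path x y t = x * (y / x) `^ t.
Proof.
move=> x0 y0; rewrite geom_pathE// expRD lnK ?posrE// /powR gt_eqF ?divr_gt0//.
by rewrite ln_div ?posrE.
Qed.

Lemma geom_path0 (x y : R) : 0 < x -> geom_path x y 0 = x.
Proof. by move=> x0; rewrite /geom_path powRr0 mul1r subr0 powRr1// ltW. Qed.

Lemma geom_path1 (x y : R) : 0 < y -> geom_path x y 1 = y.
Proof. by move=> y0; rewrite /geom_path subrr powRr0 mulr1 powRr1// ltW. Qed.

Lemma geom_path_gt0 (x y t : R) : 0 < x -> 0 < y -> 0 < geom_path x y t.
Proof. by move=> x0 y0; rewrite mulr_gt0// powR_gt0. Qed.

Lemma geom_path_itv (a b x y t : R) : 0 < a -> a <= x <= b -> a <= y <= b ->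
  0 <= t <= 1 -> a <= geom_path x y t <= b.
Proof.
move=> a0 /andP[ax xb] /andP[ay yb] /andP[t0 t1].
have x0 : 0 < x by exact: lt_le_trans ax.
have y0 : 0 < y by exact: lt_le_trans ay.
have b0 : 0 < b by exact: lt_le_trans xb.
have diag (z : R) : 0 < z -> z = z `^ t * z `^ (1 - t).
  move=> z0; rewrite -powRD; last by rewrite (gt_eqF z0) implybT.
  by rewrite addrC subrK powRr1// ltW.
rewrite /geom_path {1}(diag a)// (diag b)//.
have le_pow (u v r : R) : 0 <= r -> 0 < u -> u <= v -> u `^ r <= v `^ r.
  move=> r0 u0 uv; apply: ge0_ler_powR; rewrite ?nnegrE//; lra.
have t10 : 0 <= 1 - t by rewrite subr_ge0.
by rewrite !ler_pM ?powR_ge0 ?le_pow.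
Qed.

Lemma is_derive_geom_path (x y t : R) : 0 < x -> 0 < y ->
  is_derive t (1 : R) (geom_path x y) (geom_path x y t * (ln y - ln x)).
Proof.
move=> x0 y0.
have -> : geom_path x y = expR \o (cst (ln x) + id * cst (ln y - ln x)).
  by apply/funext => u; rewrite geom_pathE.
apply: is_derive_eq (is_derive1_comp (is_derive_expR _)
  (is_deriveD (is_derive_cst (ln x) t 1)
    (is_deriveM (is_derive_id t 1) (is_derive_cst (ln y - ln x) t 1)))) _.
by rewrite /GRing.scale/= mulr0 !add0r mulr1.
Qed.

Lemma powRr_continuous (c k : R) : 0 < c ->
  continuous (fun t : R => c `^ (k * t)).
Proof.
move=> c0 t.
have -> : (fun u => c `^ (k * u)) = expR \o ( *%R (k * ln c)).
  by apply/funext => u; rewrite /powR gt_eqF//= mulrAC.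
by apply: continuous_comp; [exact: mulrl_continuous|exact: continuous_expR].
Qed.

Lemma integrable_weight_powR (w : R -> R) (c k : R) : 0 < c ->
  measurable_fun setT w -> (forall t : R, 0 <= t <= 1 -> 0 <= w t <= 1) ->
  mu.-integrable `[0, 1] (EFin \o (fun t => w t * c `^ (k * t))).
Proof.
move=> c0 mw w01.
have ipow : mu.-integrable `[0, 1] (EFin \o (fun t => c `^ (k * t))).
  apply: continuous_compact_integrable; first exact: segment_compact.
  by apply: continuous_subspaceT => t; exact: powRr_continuous.
apply: le_integrable ipow => //.
  apply/measurable_EFinP; apply: measurable_funM; first exact: measurable_funTS.
  apply: measurable_funTS; apply: continuous_measurable_fun => t.
  exact: powRr_continuous.
move=> t /=; rewrite in_itv/= => /w01/andP[w0 w1].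
rewrite lee_fin normrM ler_piMl// ger0_norm//.
Qed.

(** The primitive is built on a slightly larger interval, which makes it
    differentiable at the end points [a] and [b] too. *)
Lemma exists_primitive (g : R -> R) (a b c d : R) : c < a -> a <= b -> b < d ->
  {in `]c, d[, continuous g} ->
  exists F : R -> R,
    (forall u, a <= u <= b -> is_derive u (1 : R) F (g u)) /\
    \int[mu]_(u in `[a, b]) g u = F b - F a.
Proof.
move=> ca leab bd cg.
pose a' := (c + a) / 2; pose b' := (b + d) / 2.
have ha' : c < a' < a by rewrite /a'; lra.
have hb' : b < b' < d by rewrite /b'; lra.
have ig : mu.-integrable `[a', b'] (EFin \o g).
  apply: continuous_compact_integrable; first exact: segment_compact.
  apply: continuous_in_subspaceT => u; rewrite inE/= in_itv/= => hu.
  by apply: cg; rewrite in_itv/=; lra.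
pose F (u : R) := \int[mu]_(v in `[a', u]) g v.
exists F; split.
  move=> u hu.
  have ub' : u < b' by lra.
  have [||dF EF] := @continuous_FTC1_closed _ g a' u b' ub' ig.
  - lra.
  - by apply: cg; rewrite in_itv/=; lra.
  by apply: (DeriveDef dF); rewrite -derive1E.
rewrite /F (@Rintegral_itvB _ g (BLeft a') (BRight b) a) ?bnd_simp//; last lra.
  rewrite Rintegral_itv_obnd_cbnd//.
  apply: integrableS ig => //; apply: subset_itv; rewrite bnd_simp; lra.
apply: integrableS ig => //; apply: subset_itv; rewrite bnd_simp; lra.
Qed.

(** The value of [f] at the end point [y] differs little from the logarithmic
    mean of [f] between [x] and [y], which is written with a primitive [F] of
    [f u / u]. In the variable [t] this mean is the increment over [0, 1] of
    [F (geom_path x y t) / (ln y - ln x)], a primitive of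
    [Phi = f \o geom_path x y], so [kernel_bound] applies. As
    [geom_path x y t = x * (y / x) `^ t], the convexity bound on [f'] gives
    a bound of [`|Phi'|] by [`|ln y - ln x| * x] times the [q]-th root of
    [(y / x) `^ (q * t)] multiplied by a combination of the two weights. Taking
    [x] to be the left or the right end of an interval gives the two kinds of
    integrals in the final estimates. *)
Lemma geom_path_bound (f f' F w : R -> R) (x y q s : R) :
  1 < q -> 0 < s -> 0 < x -> 0 < y -> x != y ->
  measurable_fun setT w -> {in `]0, 1[, continuous w} ->
  (forall t : R, 0 <= t <= 1 -> 0 <= w t <= 1) ->
  (forall t : R, 0 <= t <= 1 ->
    is_derive (geom_path x y t) (1 : R) f (f' (geom_path x y t))) ->
  (forall t : R, 0 <= t <= 1 ->
    is_derive (geom_path x y t) (1 : R) F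
      (f (geom_path x y t) / geom_path x y t)) ->
  (forall t : R, 0 <= t <= 1 -> `|f' (geom_path x y t)| `^ q <=
    t `^ s * `|f' y| `^ q + w t * `|f' x| `^ q) ->
  `|f y - (F y - F x) / (ln y - ln x)| <=
    `|ln y - ln x| * ((q - 1) / (2 * q - 1)) `^ (1 - q^-1) *
    (x * (\int[mu]_(t in `[0, 1]) (w t * (y / x) `^ (q * t)) * `|f' x| `^ q +
          \int[mu]_(t in `[0, 1]) (t `^ s * (y / x) `^ (q * t)) * `|f' y| `^ q)
         `^ q^-1).
Proof.
move=> q1 s0 x0 y0 xy mw cw w01 dvf dvF leH.
have q0 : 0 < q by lra.
have yx0 : 0 < y / x by rewrite divr_gt0.
set L := ln y - ln x.
have L0 : L != 0.
  rewrite subr_eq0; apply: contra xy => /eqP Exy.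
  by apply/eqP/ln_inj; rewrite ?posrE.
pose H t := w t * (y / x) `^ (q * t) * `|f' x| `^ q +
            t `^ s * (y / x) `^ (q * t) * `|f' y| `^ q.
have v01 t : 0 <= t <= 1 -> 0 <= t `^ s <= 1 by exact: powR_itv01.
have iw := integrable_weight_powR q yx0 mw w01.
have iv := integrable_weight_powR q yx0 (measurable_powR s) v01.
have integrableMr (g : R -> R) (k : R) :
    mu.-integrable `[0, 1] (EFin \o g) ->
    mu.-integrable `[0, 1] (EFin \o (fun t => g t * k)).
  move=> ig.
  have := @integrableZr _ _ _ mu `[0, 1] (measurable_itv _) k (EFin \o g) ig.
  by apply: eq_integrable => // t _; rewrite /= EFinM.
have iwA := integrableMr _ (`|f' x| `^ q) iw.
have ivB := integrableMr _ (`|f' y| `^ q) iv.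
have -> : \int[mu]_(t in `[0, 1]) (w t * (y / x) `^ (q * t)) * `|f' x| `^ q +
    \int[mu]_(t in `[0, 1]) (t `^ s * (y / x) `^ (q * t)) * `|f' y| `^ q =
    \int[mu]_(t in `[0, 1]) H t.
  by rewrite RintegralD//; congr (_ + _); rewrite RintegralZr.
have H0 t : 0 <= t <= 1 -> 0 <= H t.
  move=> /[dup] /w01/andP[wt0 _] /v01/andP[vt0 _].
  by rewrite /H addr_ge0// !mulr_ge0// powR_ge0.
have -> : f y = f (geom_path x y 1) by rewrite geom_path1.
have -> : (F y - F x) / L = F (geom_path x y 1) / L - F (geom_path x y 0) / L.
  by rewrite geom_path0// geom_path1// mulrBl.
rewrite mulrA [_ * _ * x]mulrAC.
apply: (@kernel_bound R (f \o geom_path x y)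
  (fun t => f' (geom_path x y t) * (geom_path x y t * L))
  (fun t => F (geom_path x y t) / L) H q (`|L| * x)) => //.
- by rewrite mulr_ge0// ltW.
- move=> t; rewrite in_itv/= => t01; have d1 := dvf t t01.
  exact: is_derive1_comp d1 (is_derive_geom_path t x0 y0).
- move=> t; rewrite in_itv/= => t01; have d1 := dvF t t01.
  apply: is_derive_eq (is_deriveM (is_derive1_comp d1
    (is_derive_geom_path t x0 y0)) (is_derive_cst L^-1 t 1)) _.
  have g0 := geom_path_gt0 t x0 y0.
  by rewrite /GRing.scale/= mulr0 add0r -/L; field; rewrite L0 gt_eqF.
- have := @integrableD _ _ _ mu `[0, 1] (measurable_itv _) _ _ iwA ivB.
  by apply: eq_integrable => // t _; rewrite /= EFinD.
- move=> t t01.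
  have t0 : 0 < t by move: t01; rewrite in_itv/= => /andP[].
  have cp := @powRr_continuous _ q yx0 t.
  apply: cvgD; (apply: cvgM; last exact: cvg_cst); apply: cvgM; try exact: cp.
    exact: cw.
  exact: powR_continuous.
- move=> t; rewrite in_itv/= => t01.
  have -> : H t = (y / x) `^ (q * t) *
      (t `^ s * `|f' y| `^ q + w t * `|f' x| `^ q) by rewrite /H; ring.
  have Ef : `|f' (geom_path x y t)| =
      (`|f' (geom_path x y t)| `^ q) `^ q^-1.
    by rewrite -powRrM mulfV ?gt_eqF// powRr1.
  rewrite powRM ?powR_ge0//; last by exact: le_trans (powR_ge0 _ _) (leH t t01).
  rewrite -powRrM [q * t / q]mulrAC mulfV ?gt_eqF// mul1r.
  rewrite normrM (normrM (geom_path x y t)) Ef.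
  rewrite (ger0_norm (ltW (geom_path_gt0 t x0 y0))).
  have -> : `|L| * x * ((y / x) `^ t *
      (t `^ s * `|f' y| `^ q + w t * `|f' x| `^ q) `^ q^-1) =
    (t `^ s * `|f' y| `^ q + w t * `|f' x| `^ q) `^ q^-1 *
      (geom_path x y t * `|L|).
    by rewrite geom_path_ratio//; ring.
  apply: ler_wpM2r; first by rewrite mulr_ge0// ltW// geom_path_gt0.
  apply: ge0_ler_powR; rewrite ?nnegrE ?powR_ge0//.
  - by rewrite invr_ge0 ltW.
  - exact: le_trans (powR_ge0 _ _) (leH t t01).
  - exact: leH.
Qed.

End geometric_path.

(** * Trapezoid and midpoint inequalities *)

Section inequalities.
Context {R : realType}.
Local Notation mu := (@lebesgue_measure R).

(** Some room is needed on both sides of [a, b]: it makes [f] differentiable at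
    [a] and [b], and continuous on an open interval around them, as
    [exists_primitive] requires. *)
Lemma interior_itv_around (I : set R) (a b : R) : is_interval I ->
  interior I a -> interior I b ->
  exists c d, [/\ c < a, b < d, I c & `]c, d[ `<=` interior I].
Proof.
move=> itvI /nbhs_ballP[e /= e0 aI] /nbhs_ballP[r /= r0 bI].
have Ic : I (a - e / 2).
  apply: aI; rewrite /ball/= opprB addrCA subrr addr0 gtr0_norm; lra.
have Id : I (b + r / 2).
  apply: bI; rewrite /ball/= opprD addrA subrr add0r normrN gtr0_norm; lra.
exists (a - e / 2), (b + r / 2); split => //; try lra.
move=> u ucd; rewrite /interior /=.
have : nbhs u `]a - e / 2, b + r / 2[%classic.
  by apply: open_nbhs_nbhs; split => //; exact: interval_open.
apply: filterS => v /=; rewrite in_itv/= => /andP[cv vd].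
by apply: (itvI _ _ Ic Id); rewrite !ltW.
Qed.

(** Both kinds of GA-convexity bound [`|f'| `^ q] by weights [t `^ s] and [w t],
    where [w t] is [(1 - t) `^ s] for the second kind and [1 - t `^ s] for the
    first, so they share this proof. The trapezoid error is half the sum of the
    errors of [geom_path_bound] from [a] to [b] and from [b] to [a]. The midpoint
    error is half the sum of those from [a] to [m] and from [b] to [m]: [m] halves
    the logarithmic length, and [(m / a) `^ (q * t) = (b / a) `^ (q / 2 * t)],
    whence the constant 4 and the exponents [q / 2]. *)
Lemma weighted_bounds (I : set R) (f w : R -> R) (a b q s : R) :
  is_interval I -> I `<=` `]0, +oo[ ->
  (forall x : R, interior I x -> derivable f x 1) ->
  interior I a -> interior I b -> a < b -> 1 < q -> 0 < s ->
  measurable_fun setT w -> {in `]0, 1[, continuous w} ->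
  (forall t : R, 0 <= t <= 1 -> 0 <= w t <= 1) ->
  (forall x y t : R, a <= x <= b -> a <= y <= b -> 0 <= t <= 1 ->
    `|derive1 f (geom_path x y t)| `^ q <=
      t `^ s * `|derive1 f y| `^ q + w t * `|derive1 f x| `^ q) ->
  let v := fun t : R => t `^ s in
  let W (h : R -> R) c k := \int[mu]_(t in `[0, 1]) (h t * c `^ (k * t)) in
  let m := Num.sqrt (a * b) in
  let D x := `|derive1 f x| `^ q in
  let avg := (ln b - ln a)^-1 * \int[mu]_(x in `[a, b]) (f x / x) in
  let N := ((q - 1) / (2 * q - 1)) `^ (1 - q^-1) in
  `|(f a + f b) / 2 - avg| <= ln (b / a) / 2 * N *
     (a * (W w (b / a) q * D a + W v (b / a) q * D b) `^ q^-1 +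
      b * (W w (a / b) q * D b + W v (a / b) q * D a) `^ q^-1) /\
  `|f m - avg| <= ln (b / a) / 4 * N *
     (a * (W w (b / a) (q / 2) * D a + W v (b / a) (q / 2) * D m) `^ q^-1 +
      b * (W w (a / b) (q / 2) * D b + W v (a / b) (q / 2) * D m) `^ q^-1).
Proof.
move=> itvI posI df Ia Ib ab q1 s0 mw cw w01 conv v W m D avg N.
have [c [d [ca bd Ic sub]]] := interior_itv_around itvI Ia Ib.
have c0 : 0 < c by have := posI _ Ic; rewrite /= in_itv/= andbT.
have a0 : 0 < a by lra.
have b0 : 0 < b by lra.
have dvf u : c < u < d -> is_derive u (1 : R) f (derive1 f u).
  move=> ucd; apply: DeriveDef; last by rewrite derive1E.
  by apply: df; apply: sub; rewrite /= in_itv.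
have [|F [dvF EF]] :=
    @exists_primitive R (fun u => f u / u) a b c d ca (ltW ab) bd.
  move=> u; rewrite in_itv/= => ucd.
  apply: cvgM.
    have [du _] := dvf u ucd.
    by apply: differentiable_continuous; apply/derivable1_diffP.
  by apply: cvgV; [lra|exact: cvg_id].
have half x y : a <= x <= b -> a <= y <= b -> x != y ->
  `|f y - (F y - F x) / (ln y - ln x)| <= `|ln y - ln x| * N *
    (x * (W w (y / x) q * D x + W v (y / x) q * D y) `^ q^-1).
  move=> hx hy xy.
  have x0 : 0 < x by case/andP: hx => ax _; exact: lt_le_trans ax.
  have y0 : 0 < y by case/andP: hy => ay _; exact: lt_le_trans ay.
  apply: (@geom_path_bound R f (derive1 f) F w x y q s
    q1 s0 x0 y0 xy mw cw w01).
  - move=> t t01; apply: dvf.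
    have /andP[ag gb] := geom_path_itv a0 hx hy t01.
    by rewrite (lt_le_trans ca ag) (le_lt_trans gb bd).
  - by move=> t t01; apply: dvF; exact: geom_path_itv.
  - by move=> t t01; exact: conv.
have lab : ln a < ln b by rewrite ltr_ln ?posrE.
have Lab : ln (b / a) = ln b - ln a by rewrite ln_div ?posrE.
have m0 : 0 < m by rewrite sqrtr_gt0 mulr_gt0.
have mm : m ^+ 2 = a * b by rewrite sqr_sqrtr// mulr_ge0// ltW.
have lnm : ln m = (ln a + ln b) / 2.
  have : ln (m ^+ 2) = ln a + ln b by rewrite mm lnM ?posrE.
  by rewrite lnXn// => <-; rewrite -mulr_natr; field.
have am : a < m by rewrite -ltr_ln ?posrE// lnm; lra.
have mb : m < b by rewrite -ltr_ln ?posrE// lnm; lra.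
have Wm h x : 0 < x -> W h (m / x) q = W h ((a * b / x) / x) (q / 2).
  move=> x0; apply: eq_Rintegral => t _; congr (_ * _).
  rewrite /powR !gt_eqF ?divr_gt0 ?mulr_gt0//; congr expR.
  by rewrite !ln_div ?lnM ?posrE ?divr_gt0 ?mulr_gt0// lnm; field.
have combine (S T X Y k : R) : `|S| <= k * N * X -> `|T| <= k * N * Y ->
    `|(S + T) / 2| <= k / 2 * N * (X + Y).
  move=> hS hT; rewrite normrM [`|2^-1|]gtr0_norm ?invr_gt0//.
  rewrite (_ : k / 2 * N * (X + Y) = (k * N * X + k * N * Y) / 2); last by ring.
  by apply: ler_wpM2r => //; apply: le_trans (ler_normD _ _) (lerD hS hT).
have La : `|ln a - ln b| = ln (b / a).
  by rewrite distrC Lab gtr0_norm// subr_gt0.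
have Lb : `|ln b - ln a| = ln (b / a) by rewrite distrC.
have Lma : `|ln m - ln a| = ln (b / a) / 2 by rewrite Lab lnm gtr0_norm; lra.
have Lmb : `|ln m - ln b| = ln (b / a) / 2.
  by rewrite distrC Lab lnm gtr0_norm; lra.
have hxa : a <= a <= b by rewrite lexx ltW.
have hxb : a <= b <= b by rewrite lexx ltW.
have hxm : a <= m <= b by rewrite !ltW.
split.
- have hab := half a b hxa hxb (negbT (lt_eqF ab)).
  have hba := half b a hxb hxa (negbT (gt_eqF ab)).
  rewrite La in hba; rewrite Lb in hab.
  have E : (f a + f b) / 2 - avg = ((f b - (F b - F a) / (ln b - ln a)) +
      (f a - (F a - F b) / (ln a - ln b))) / 2.
    by rewrite /avg EF; field; rewrite !subr_eq0 !neq_lt lab orbT.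
  by rewrite E; exact: combine hab hba.
- have ham := half a m hxa hxm (negbT (lt_eqF am)).
  have hbm := half b m hxb hxm (negbT (gt_eqF mb)).
  have Ea : a * b / a = b by rewrite mulrAC divff ?mul1r ?gt_eqF.
  have Eb : a * b / b = a by rewrite mulfK ?gt_eqF.
  rewrite Lma !Wm// Ea in ham; rewrite Lmb !Wm// Eb in hbm.
  have E : f m - avg = ((f m - (F m - F a) / (ln m - ln a)) +
      (f m - (F m - F b) / (ln m - ln b))) / 2.
    rewrite /avg EF lnm; field.
    clear -lab; apply/andP.
    by split; [rewrite lt_eqF//|rewrite gt_eqF//]; lra.
  rewrite E (_ : 4 = 2 * 2); last by ring.
  by rewrite invfM mulrA; exact: combine ham hbm.
Qed.

End inequalities.

Theorem theorem9 (R : realType) (I : set R) (f : R -> R) (a b q s : R)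
  (I_itv : is_interval I) (I_pos : I `<=` `]0, +oo[)
  (f_diff : forall x : R, interior I x -> derivable f x 1)
  (Ia : interior I a) (Ib : interior I b) (ab : a < b)
  (f'_int : lebesgue_measure.-integrable `[a, b] (EFin \o derive1 f))
  (q1 : 1 < q) (s01 : 0 < s <= 1) :
  (GA_s_convex_second s `[a, b] (fun x => `|derive1 f x| `^ q) ->
    `|(f a + f b) / 2 -
        (ln b - ln a)^-1 * \int[lebesgue_measure]_(x in `[a, b]) (f x / x)|
    <= ln (b / a) / 2 * ((q - 1) / (2 * q - 1)) `^ (1 - q^-1) *
       (a * (c7 a b s q * `|derive1 f a| `^ q +
             c8 a b s q * `|derive1 f b| `^ q) `^ q^-1 +
        b * (c9 a b s q * `|derive1 f b| `^ q +
             c10 a b s q * `|derive1 f a| `^ q) `^ q^-1)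
    /\
    `|f (Num.sqrt (a * b)) -
        (ln b - ln a)^-1 * \int[lebesgue_measure]_(x in `[a, b]) (f x / x)|
    <= ln (b / a) / 4 * ((q - 1) / (2 * q - 1)) `^ (1 - q^-1) *
       (a * (c7 a b s (q / 2) * `|derive1 f a| `^ q +
             c8 a b s (q / 2) * `|derive1 f (Num.sqrt (a * b))| `^ q) `^ q^-1 +
        b * (c9 a b s (q / 2) * `|derive1 f b| `^ q +
             c10 a b s (q / 2) * `|derive1 f (Num.sqrt (a * b))| `^ q) `^ q^-1))
  /\
  (GA_s_convex_first s `[a, b] (fun x => `|derive1 f x| `^ q) ->
    `|(f a + f b) / 2 -
        (ln b - ln a)^-1 * \int[lebesgue_measure]_(x in `[a, b]) (f x / x)|
    <= ln (b / a) / 2 * ((q - 1) / (2 * q - 1)) `^ (1 - q^-1) *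
       (a * (c11 a b s q * `|derive1 f a| `^ q +
             c8 a b s q * `|derive1 f b| `^ q) `^ q^-1 +
        b * (c12 a b s q * `|derive1 f b| `^ q +
             c10 a b s q * `|derive1 f a| `^ q) `^ q^-1)
    /\
    `|f (Num.sqrt (a * b)) -
        (ln b - ln a)^-1 * \int[lebesgue_measure]_(x in `[a, b]) (f x / x)|
    <= ln (b / a) / 4 * ((q - 1) / (2 * q - 1)) `^ (1 - q^-1) *
       (a * (c11 a b s (q / 2) * `|derive1 f a| `^ q +
             c8 a b s (q / 2) * `|derive1 f (Num.sqrt (a * b))| `^ q) `^ q^-1 +
        b * (c12 a b s (q / 2) * `|derive1 f b| `^ q +
             c10 a b s (q / 2) * `|derive1 f (Num.sqrt (a * b))| `^ q) `^ q^-1)).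
Proof.
have /andP[s0 _] := s01.
split=> conv.
- apply: (@weighted_bounds R I f (fun t => (1 - t) `^ s) a b q s
    I_itv I_pos f_diff Ia Ib ab q1 s0).
  + apply: (measurableT_comp (measurable_powR s)).
    exact: measurable_funB.
  + move=> t; rewrite in_itv/= => /andP[_ t1].
    have c1 : {for t, continuous (fun u : R => 1 - u)}.
      by apply: cvgB; [exact: cvg_cst|exact: cvg_id].
    have c2 : {for 1 - t, continuous (fun u : R => u `^ s)}.
      by apply: powR_continuous; rewrite subr_gt0.
    exact: (@continuous_comp _ _ _ _ (fun u : R => u `^ s) _ c1 c2).
  + move=> t t01; apply: powR_itv01 => //; lra.
  + by move=> x y t hx hy t01; apply: conv; rewrite ?in_itv.
- apply: (@weighted_bounds R I f (fun t => 1 - t `^ s) a b q s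
    I_itv I_pos f_diff Ia Ib ab q1 s0).
  + apply: measurable_funB => //; exact: measurable_powR.
  + move=> t; rewrite in_itv/= => /andP[t0 _].
    by apply: cvgB; [exact: cvg_cst|exact: powR_continuous].
  + by move=> t /(powR_itv01 s0); lra.
  + by move=> x y t hx hy t01; apply: conv; rewrite ?in_itv.
Qed.
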